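(* Let $p \geq 11$ be a prime. Then for every integer $g$ with $\gcd(g,p)=1$ we have $$N_g(1) \leq \sqrt{2p} + \frac12 .$$
   Context: For a prime $p$ and an integer $g$ with $\gcd(g,p)=1$, the function $f_g$ is defined on nonnegative integers $u$ by the conditions $f_g(u) \equiv g^u \pmod p$ and $0 \leq f_g(u) \leq p-1$. For an initial value $u_0$ consider the sequence $u_n = f_g(u_{n-1})$, $n = 1,2,\ldots$. For a positive integer $k$, $N_g(k)$ denotes the number of $u_0 \in \{1,\ldots,p-1\}$ for which $u_k = u_0$. In particular, $N_g(1)$ is the number of $u \in \{1,\ldots,p-1\}$ with $f_g(u)=u$. *)

(* Defs.v *)
From mathcomp Require Import all_boot all_order all_algebra.
Set Implicit Arguments.
Unset Strict Implicit.
Unset Printing Implicit Defensive.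

Import Order.TTheory GRing.Theory Num.Theory.
Local Open Scope ring_scope.

(* The residue [(_ %% p)%Z] is the least nonnegative one for [p != 0], so the
   absolute value only casts it from [int] to [nat]; see [fexpP] and
   [fexp_uniq]. *)
Definition fexp (p : nat) (g : int) (u : nat) : nat :=
  `|(g ^+ u %% p%:Z)%Z|%N.

Definition fexp_seq (p : nat) (g : int) (u0 : nat) (n : nat) : nat :=
  iter n (fexp p g) u0.

Definition Ncyc (p : nat) (g : int) (k : nat) : nat :=
  #|[set u0 : 'I_p | (1 <= u0)%N && (fexp_seq p g u0 k == u0 :> nat)]|.

Lemma fexpP (p : nat) (g : int) (u : nat) : (0 < p)%N ->
  ((fexp p g u)%:Z = g ^+ u %[mod p%:Z])%Z /\ (fexp p g u <= p.-1)%N.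
Proof.
move=> p_gt0; have pn0 : p%:Z != 0 by rewrite eqz_nat -lt0n.
have r_ge0 := modz_ge0 (g ^+ u) pn0.
have fE : (fexp p g u)%:Z = (g ^+ u %% p%:Z)%Z by rewrite /fexp gez0_abs.
split; first by rewrite fE modz_mod.
by rewrite -ltnS prednK // -ltz_nat fE ltz_pmod.
Qed.

Lemma fexp_uniq (p : nat) (g : int) (u v : nat) : (0 < p)%N ->
  (v%:Z = g ^+ u %[mod p%:Z])%Z -> (v <= p.-1)%N -> v = fexp p g u.
Proof.
move=> p_gt0 vE; rewrite -ltnS prednK // => v_lt.
by rewrite /fexp -vE modz_nat absz_nat modn_small.
Qed.

(* Main.v *)
(** If [u] and [u + d] are both fixed points, then [u (g^d - 1) = d] mod [p].
    For [0 < d < p] this forces [g^d - 1] to be invertible, so [d] determines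
    [u]: the fixed points form a Sidon set in [{1, ..., p-1}], and the [N (N - 1)]
    signed differences of distinct elements are distinct. *)
Require Import Defs.
From mathcomp Require Import all_boot all_order all_algebra.
From mathcomp Require Import reals.
From mathcomp Require Import zify ring lra.
Import Order.TTheory GRing.Theory Num.Theory.
Local Open Scope ring_scope.

(** Signed differences of ordered pairs of distinct elements are pairwise distinct and, shifted by
    [n], lie in [[1, 2n - 1]]. The Sidon condition is stated additively to avoid truncated
    subtraction, and only for positive differences. *)
Lemma card_sidon_ord (n : nat) (A : {set 'I_n}) :
    {in A & A, forall u v : 'I_n, {in A & A, forall u' v' : 'I_n,
      (u < v)%N -> (v + u' = v' + u)%N -> u = u'}} ->
  (#|A| * #|A|.-1 <= n.*2.-1)%N.
Proof.
move=> sidonA; pose D := [set x in setX A A | x.1 != x.2].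
have cardD : #|D| = (#|A| * #|A|.-1)%N.
  (* The complement of [D] in the square is the diagonal, a copy of [A]. *)
  have diagE : setX A A :\: D = [set (u, u) | u in A].
    apply/setP => -[u v]; rewrite !inE /=.
    apply/idP/imsetP => [|[w wA [-> ->]]]; last by rewrite wA eqxx.
    case: eqP => [<- /andP[_ /andP[uA _]]|_ /andP[]]; first by exists u.
    by rewrite andbT; case: (_ && _).
  have cardE := cardsID D (setX A A).
  rewrite diagE card_imset ?cardsX in cardE; last by move=> u v [].
  have DE : setX A A :&: D = D.
    by apply/setIidPr/subsetP => x; rewrite inE => /andP[].
  by rewrite DE in cardE; case: #|A| cardE => [|m] /=; lia.
(* Adding [n] first keeps the subtraction from truncating. *)
pose diff (x : 'I_n * 'I_n) := (x.1 + n - x.2)%N.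
have diff_inj : {in enum D &, injective diff}.
  move=> [u v] [u' v']; rewrite !mem_enum !inE /= /diff /=.
  move=> /andP[/andP[uA vA] neq_uv] /andP[/andP[u'A v'A] _] eq_diff.
  have [[[ltu ltv] ltu'] ltv'] := (ltn_ord u, ltn_ord v, ltn_ord u', ltn_ord v').
  case: (ltngtP u v) => [ltuv|ltvu|/val_inj equv].
  - have eqs : (v + u' = v' + u)%N by lia.
    have equ := sidonA u v uA vA u' v' u'A v'A ltuv eqs.
    by move: eqs; rewrite -equ => eqs; congr (_, _); apply: val_inj => /=; lia.
  (* A negative difference reduces to a positive one by reversing both pairs. *)
  - have eqs : (u + v' = u' + v)%N by lia.
    have eqv := sidonA v u vA uA v' u' v'A u'A ltvu eqs.
    by move: eqs; rewrite -eqv => eqs; congr (_, _); apply: val_inj => /=; lia.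
  - by rewrite equv eqxx in neq_uv.
rewrite -cardD cardE -(size_map diff) -(size_iota 1 n.*2.-1).
apply: uniq_leq_size; first by rewrite map_inj_in_uniq ?enum_uniq.
move=> _ /mapP[[u v] _ ->]; rewrite mem_iota /diff /=.
by have := (ltn_ord u, ltn_ord v) => -[]; lia.
Qed.

Lemma fexp_fixed_dvd (p : nat) (g : int) (u : nat) : (0 < p)%N ->
  fexp p g u = u -> (p%:Z %| g ^+ u - u%:Z)%Z.
Proof.
move=> p_gt0 fixu; rewrite -eqz_mod_dvd; apply/eqP.
by have [/esym] := fexpP g u p_gt0; rewrite fixu.
Qed.

Lemma fexp_fixed_sidon (p : nat) (g : int) (u u' d : nat) : prime p ->
    (0 < d < p)%N -> (u < p)%N -> (u' < p)%N ->
    fexp p g u = u -> fexp p g (u + d) = (u + d)%N ->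
    fexp p g u' = u' -> fexp p g (u' + d) = (u' + d)%N ->
  u = u'.
Proof.
move=> p_prime /andP[d_gt0 ltdp] ltup ltu'p fixu fixud fixu' fixu'd.
have p_gt0 := prime_gt0 p_prime.
have step w : fexp p g w = w -> fexp p g (w + d) = (w + d)%N ->
    (p%:Z %| w%:Z * (g ^+ d - 1) - d%:Z)%Z.
  move=> /(fexp_fixed_dvd p g _ p_gt0) dvdw /(fexp_fixed_dvd p g _ p_gt0) dvdwd.
  (* Substitute [g^w = w] into [g^(w + d) = w + d] modulo [p]. *)
  have -> : w%:Z * (g ^+ d - 1) - d%:Z =
      (g ^+ (w + d) - (w + d)%:Z) - g ^+ d * (g ^+ w - w%:Z).
    by rewrite exprD PoszD; ring.
  by rewrite rpredB // dvdz_mull.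
have dvdu := step u fixu fixud.
have : (p%:Z %| (u%:Z - u'%:Z) * (g ^+ d - 1))%Z.
  have -> : (u%:Z - u'%:Z) * (g ^+ d - 1) =
      (u%:Z * (g ^+ d - 1) - d%:Z) - (u'%:Z * (g ^+ d - 1) - d%:Z) by ring.
  by rewrite rpredB // step.
(* Either [u = u'], both being below [p], or [g^d = 1] modulo [p], which makes [p] divide [d]. *)
rewrite dvdzE abszM Euclid_dvdM // => /orP[dvd_uu'|dvd_gd].
  have /eqP : (u%:Z == u'%:Z %[mod p%:Z])%Z by rewrite eqz_mod_dvd dvdzE.
  by rewrite !modz_nat !modn_small // => -[].
have : (p%:Z %| d%:Z)%Z.
  have -> : d%:Z = u%:Z * (g ^+ d - 1) - (u%:Z * (g ^+ d - 1) - d%:Z) by ring.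
  by rewrite rpredB // dvdz_mull // dvdzE.
by rewrite dvdzE /= => /dvdn_leq; lia.
Qed.

Theorem theorem2 (R : realType) (p : nat) (p_prime : prime p)
    (p_ge11 : (11 <= p)%N) (g : int) (g_p_coprime : coprimez g p%:Z) :
  (Ncyc p g 1)%:R <= Num.sqrt (2 * p%:R) + 1 / 2 :> R.
Proof.
have : (Ncyc p g 1 * (Ncyc p g 1).-1 <= p.*2.-1)%N.
  apply: card_sidon_ord => u v; rewrite !inE /fexp_seq /=.
  move=> /andP[_ /eqP fixu] /andP[_ /eqP fixv] u' v'; rewrite !inE /=.
  move=> /andP[_ /eqP fixu'] /andP[_ /eqP fixv'] ltuv eqs.
  have [ltvp ltu'p] := (ltn_ord v, ltn_ord u').
  have vE : (u + (v - u))%N = v by lia.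
  have v'E : (u' + (v - u))%N = v' by lia.
  apply: val_inj; apply: (@fexp_fixed_sidon p g u u' (v - u)) => //.
  - by lia.
  - by rewrite vE.
  - by rewrite v'E.
set N := Ncyc p g 1 => leN.
(* The case split clears the truncated predecessor at [N = 0]. *)
have leNN : (N * N + 1 <= 2 * p + N)%N by case: N leN => [|n] /=; lia.
have leNR : N%:R * N%:R + 1 <= 2 * p%:R + N%:R :> R.
  by move: leNN; rewrite -(ler_nat R) !natrD !natrM; lra.
(* Completing the square: [(N - 1/2)^2 = N^2 - N + 1/4 <= 2p - 3/4]. *)
rewrite -lerBlDr (le_trans (ler_norm _)) // -sqrtr_sqr ler_wsqrtr // expr2.
lra.
Qed.
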